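(* Let $\mathcal{I}$ and $\mathcal{J}$ be ideals on $\omega$. Then (1) $\mathfrak{b}(\mathcal{I}\oplus\mathcal{J},\mathcal{I}\oplus\mathcal{J},\mathcal{I}\oplus\mathcal{J})=\min\{\mathfrak{b}(\mathcal{I},\mathcal{I},\mathcal{I}),\mathfrak{b}(\mathcal{J},\mathcal{J},\mathcal{J})\}$; (2) $\mathfrak{b}(\mathcal{I}\oplus\mathcal{J},\mathcal{I}\oplus\mathcal{J},\mathrm{Fin})=\min\{\mathfrak{b}(\mathcal{I},\mathcal{I},\mathrm{Fin}),\mathfrak{b}(\mathcal{J},\mathcal{J},\mathrm{Fin})\}$; (3) $\mathfrak{b}(\mathcal{I}\oplus\mathcal{J},\mathrm{Fin},\mathrm{Fin})=\min\{\mathfrak{b}(\mathcal{I},\mathrm{Fin},\mathrm{Fin}),\mathfrak{b}(\mathcal{J},\mathrm{Fin},\mathrm{Fin})\}$; (4) $\mathfrak{b}_s(\mathrm{Fin},\mathcal{I}\oplus\mathcal{J},\mathcal{I}\oplus\mathcal{J})=\min\{\mathfrak{b}_s(\mathrm{Fin},\mathcal{I},\mathcal{I}),\mathfrak{b}_s(\mathrm{Fin},\mathcal{J},\mathcal{J})\}$.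
   Context: An ideal on a countable infinite set $X$ is a family $\mathcal{I}\subseteq\mathcal{P}(X)$ closed under finite unions and subsets, containing all finite subsets, with $X\notin\mathcal{I}$; $\mathrm{Fin}$ denotes the ideal of finite subsets of the relevant set. For ideals $\mathcal{I},\mathcal{J}$ on $\omega$, $\mathcal{I}\oplus\mathcal{J}$ is the ideal on $\omega\times\{0,1\}$ consisting of all $A$ with $\{x:(x,0)\in A\}\in\mathcal{I}$ and $\{y:(y,1)\in A\}\in\mathcal{J}$. For an ideal $\mathcal{K}$ on $X$, $\widehat{\mathcal{P}}_{\mathcal{K}}$ is the family of sequences $\langle A_n:n\in\omega\rangle$ of pairwise disjoint members of $\mathcal{K}$, and $\mathcal{P}_{\mathcal{K}}$ those with union $X$. For ideals $\mathcal{I},\mathcal{J},\mathcal{K}$ on $X$: $\mathfrak{b}(\mathcal{I},\mathcal{J},\mathcal{K})=\min\{|\mathcal{E}|:\mathcal{E}\subseteq\widehat{\mathcal{P}}_{\mathcal{K}},\ \forall\langle A_n\rangle\in\mathcal{P}_{\mathcal{J}}\ \exists\langle E_n\rangle\in\mathcal{E}\ \bigcup_n(A_n\cap\bigcup_{i\le n}E_i)\notin\mathcal{I}\}$ and $\mathfrak{b}_s(\mathcal{I},\mathcal{J},\mathcal{K})$ is the same with $A_{n+1}$ in place of $A_n$; $\min\emptyset=\mathfrak{c}^+$. *)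

(* Defs.v *)
From HB Require Import structures.
From mathcomp Require Import all_boot all_classical.

Set Implicit Arguments.
Unset Strict Implicit.
Unset Printing Implicit Defensive.

Local Open Scope classical_set_scope.
Local Open Scope card_scope.

(* A cardinal is an equipotence class of types, so that Leibniz equality of
   cardinals is equipotence.  Collections of types and of cardinals are written
   [_ -> Prop] rather than [set _]: [set] is universe monomorphic, and applying
   it to [Type] would exclude [set nat] from the types having a cardinality. *)
Definition cardinal :=
  {C : Type -> Prop |
    exists T : Type, C = (fun U : Type => [set: U] #= [set: T] : Prop)}.

Lemma cardinality_subproof (T : Type) (A : set T) :
  exists T0 : Type, (fun U : Type => [set: U] #= A : Prop)
                  = (fun U : Type => [set: U] #= [set: T0] : Prop).
Proof.
by exists A; apply/funext => U; rewrite (card_eqr (card_setT A)).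
Qed.

Definition cardinality (T : Type) (A : set T) : cardinal :=
  exist _ _ (cardinality_subproof A).

Definition cardinal_le (k l : cardinal) : Prop :=
  exists T U : Type, [/\ sval k T, sval l U & [set: T] #<= [set: U]].

Definition cardinal_lt (k l : cardinal) : Prop := cardinal_le k l /\ k <> l.

Definition is_least (S : cardinal -> Prop) (k : cardinal) : Prop :=
  S k /\ forall l, S l -> cardinal_le k l.

(* The minimum of [S], with the convention that the minimum of the empty
   collection is [d]; see [cardinal_minP] and [cardinal_min0]. *)
Definition cardinal_min (d : cardinal) (S : cardinal -> Prop) : cardinal :=
  if pselect (exists k, is_least S k) is left h then sval (cid h) else d.

Definition cardinal_min2 (k l : cardinal) : cardinal :=
  if `[< cardinal_le k l >] then k else l.

Definition continuum : cardinal := cardinality [set: set nat].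

(* The default value is irrelevant: by Cantor's theorem some cardinal is larger
   than the continuum. *)
Definition continuum_succ : cardinal :=
  cardinal_min continuum (cardinal_lt continuum).

Lemma cardinality_eqP (T U : Type) (A : set T) (B : set U) :
  cardinality A = cardinality B <-> A #= B.
Proof.
split=> [e|AB].
  have : sval (cardinality A) A by exact: card_setT.
  by rewrite e /= (card_eql (card_setT A)).
apply: eq_exist; apply/funext => V; by rewrite (card_eqr AB).
Qed.

Lemma cardinalityE (k : cardinal) : exists T : Type, k = cardinality [set: T].
Proof. by case: k => C [T CE]; exists T; apply: eq_exist. Qed.

Lemma cardinality_leP (T U : Type) (A : set T) (B : set U) :
  cardinal_le (cardinality A) (cardinality B) <-> A #<= B.
Proof.
split=> [[V [W [/= VA WB]]]|AB].
  by rewrite (card_le_eql VA) (card_le_eqr WB).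
exists A, B; split; [exact: card_setT|exact: card_setT|].
by rewrite (card_le_eql (card_setT A)) (card_le_eqr (card_setT B)).
Qed.

Lemma inj_type_card_le (T U : Type) (f : T -> U) :
  injective f -> [set: T] #<= [set: U].
Proof.
move=> finj; have /card_le_eql <- : f @` [set: T] #= [set: T].
  by apply: inj_card_eq => x y _ _; exact: finj.
exact: card_leT.
Qed.

Lemma card_le_subset_of (T U : Type) : [set: T] #<= [set: U] ->
  exists A : set U, A #= [set: T].
Proof.
move=> /card_leP[f]; exists (range (fun x => val (f x))).
apply: (card_eq_trans (inj_card_eq _)) (card_setT _) => x y _ _.
by move=> /val_inj; apply: inj; rewrite inE.
Qed.

Lemma least_type_of_family (J : Type) (F : J -> Type) : inhabited J ->
  exists i, forall j, [set: F i] #<= [set: F j].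
Proof.
move=> [j0].
pose P (W : set (forall i, F i)) :=
  forall f g, W f -> W g -> forall i, f i = g i -> f = g.
have [|W [PW maxW]] := @Zorn_bigcup _ P.
  move=> C CP Ctot f g [A CA Af] [B CB Bg].
  by have [AB|BA] := Ctot _ _ CA CB; [apply: (CP _ CB) => //; exact: AB|
                                      apply: (CP _ CA) => //; exact: BA].
have [i Wi] : exists i, forall x : F i, exists2 f, W f & f i = x.
  apply: contrapT => /forallNP H.
  have {}H i : exists x : F i, forall f, W f -> f i <> x.
    move: (H i) => /existsNP[x Hx]; exists x => f Wf fx.
    by apply: Hx; exists f.
  pose h i := sval (cid (H i)).
  have hW f i : W f -> f i <> h i by move=> Wf; exact: (svalP (cid (H i)) f Wf).
  apply: (maxW (W `|` [set h])).
    split=> [f Wf|/(_ h (or_intror erefl)) Wh]; first by left.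
    exact: (hW h j0 Wh).
  move=> f g [Wf|->] [Wg|->] i // e; first exact: PW e.
  - by case: (hW f i Wf).
  - by case: (hW g i Wg).
exists i => j.
pose s (x : F i) := s2val (cid2 (Wi x)).
have sW x : W (s x) by exact: s2valP (cid2 (Wi x)).
have sE x : s x i = x by exact: s2valP' (cid2 (Wi x)).
apply: (@inj_type_card_le _ _ (fun x : F i => s x j)) => x y e.
by rewrite -(sE x) -(sE y) (PW _ _ (sW x) (sW y) _ e).
Qed.

Lemma cardinal_le_total (k l : cardinal) : cardinal_le k l \/ cardinal_le l k.
Proof.
have [T ->] := cardinalityE k; have [U ->] := cardinalityE l.
have [[] /= le] := @least_type_of_family bool (fun b => if b then T else U)
  (inhabits true).
- by left; apply/cardinality_leP/(le false).
- by right; apply/cardinality_leP/(le true).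
Qed.

Lemma exists_least (S : cardinal -> Prop) :
  (exists k, S k) -> exists k, is_least S k.
Proof.
move=> [k Sk]; have [T kE] := cardinalityE k.
pose J := {A : set T | S (cardinality A)}.
have ST : S (cardinality [set: T]) by rewrite -kE.
have [A minA] := @least_type_of_family J (fun A => set_type (sval A))
  (inhabits (exist _ setT ST)).
have {}minA (B : set T) : S (cardinality B) -> sval A #<= B.
  move=> SB; have := minA (exist _ B SB).
  by rewrite /= (card_le_eql (card_setT _)) (card_le_eqr (card_setT _)).
exists (cardinality (sval A)); split; first exact: svalP A.
move=> l; have [U ->] := cardinalityE l => Sl.
apply/cardinality_leP.
have [|/cardinality_leP/card_le_subset_of[B BU]] :=
  cardinal_le_total (cardinality [set: T]) (cardinality [set: U]).
  by move=> /cardinality_leP; exact/card_le_trans/minA.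
rewrite -(card_le_eqr BU); apply: minA.
by have /cardinality_eqP -> := BU.
Qed.

Lemma cardinal_minP (d : cardinal) (S : cardinal -> Prop) :
  (exists k, S k) -> is_least S (cardinal_min d S).
Proof.
move=> /exists_least h; rewrite /cardinal_min.
by case: pselect => [h'|//]; case: (cid h').
Qed.

Lemma cardinal_min0 (d : cardinal) (S : cardinal -> Prop) :
  ~ (exists k, S k) -> cardinal_min d S = d.
Proof.
move=> S0; rewrite /cardinal_min; case: pselect => // h.
by case: S0; case: h => k [Sk _]; exists k.
Qed.

Lemma continuum_succP : is_least (cardinal_lt continuum) continuum_succ.
Proof.
apply: cardinal_minP; exists (cardinality [set: set (set nat)]); split.
  apply/cardinality_leP/(@inj_type_card_le _ _ set1) => A B.
  by move=> /seteqP[/(_ A erefl)].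
move=> /cardinality_eqP; rewrite card_eq_sym card_eq_le => /andP[+ _].
move=> /pcard_injP[g ginj].
pose D : set (set nat) := [set a | exists2 S, a = g S & ~ S a].
have nD : ~ D (g D).
  move=> [S gS nS]; have SD : D = S by apply: ginj gS; rewrite inE.
  by apply: (nS); rewrite -SD; exists S.
by apply: (nD); exists D.
Qed.

Definition is_ideal (X : Type) (I : set (set X)) : Prop :=
  [/\ forall A B, I A -> I B -> I (A `|` B),
      forall A B, A `<=` B -> I B -> I A,
      forall A, finite_set A -> I A
    & ~ I setT].

Definition Fin {X : Type} : set (set X) := [set A | finite_set A].

(* On [nat * bool], with [false] and [true] in the roles of 0 and 1. *)
Definition ideal_sum (I J : set (set nat)) : set (set (nat * bool)) :=
  [set A | I [set x | A (x, false)] /\ J [set y | A (y, true)]].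

Lemma ideal_sum_ideal (I J : set (set nat)) :
  is_ideal I -> is_ideal J -> is_ideal (ideal_sum I J).
Proof.
move=> [IU IS IF IT] [JU JS JF JT]; split.
- by move=> A B [IA JA] [IB JB]; split; [exact: IU IA IB|exact: JU JA JB].
- move=> A B AB [IB JB]; split; [apply: IS IB|apply: JS JB] => x /=; exact: AB.
- move=> A Afin; split; [apply: IF|apply: JF].
  + by apply: (finite_preimage (f := pair^~ false)) Afin => x y _ _ [].
  + by apply: (finite_preimage (f := pair^~ true)) Afin => x y _ _ [].
- by move=> [/IT].
Qed.

Definition Phat (X : Type) (K : set (set X)) : set (nat -> set X) :=
  [set A | (forall n, K (A n)) /\ trivIset setT A].

Definition Ppart (X : Type) (K : set (set X)) : set (nat -> set X) :=
  [set A | Phat K A /\ \bigcup_n A n = setT].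

Definition bnum (X : Type) (I J K : set (set X)) : cardinal :=
  cardinal_min continuum_succ (fun k =>
    exists F : set (nat -> set X),
    [/\ F `<=` Phat K,
        forall A, Ppart J A -> exists2 E, F E &
          ~ I (\bigcup_n (A n `&` \bigcup_(i in [set i | (i <= n)%N]) E i))
      & k = cardinality F]).

Definition bsnum (X : Type) (I J K : set (set X)) : cardinal :=
  cardinal_min continuum_succ (fun k =>
    exists F : set (nat -> set X),
    [/\ F `<=` Phat K,
        forall A, Ppart J A -> exists2 E, F E &
          ~ I (\bigcup_n (A n.+1 `&` \bigcup_(i in [set i | (i <= n)%N]) E i))
      & k = cardinality F]).

(* Main.v *)
(* A set in [X * B] is the same thing as a family of slices in [X], one for each
   point of [B], and slicing commutes with all the operations in the definition
   of the invariants.  So for any family of ideals indexed by a countable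
   nonempty [B], the invariant of the sum is the least of the invariants of the
   summands.  An unbounded family on one copy of [X], extended by the empty set
   on the others, is unbounded on [X * B].  Conversely, if none of the families
   of slices of [F] is unbounded, then the partitions bounding them glue to a
   partition bounding [F].  Every family has size at most the continuum, so that
   a summand without unbounded family, whose invariant is [continuum_succ], does
   not affect the minimum.  Finally [Fin] is itself a sum of copies of [Fin] when
   [B] is finite. *)
Require Import Defs.
From mathcomp Require Import all_boot all_classical.

Set Implicit Arguments.
Unset Strict Implicit.
Unset Printing Implicit Defensive.

Local Open Scope classical_set_scope.
Local Open Scope card_scope.

Lemma cardinal_le_refl (k : cardinal) : cardinal_le k k.
Proof. by have [T ->] := cardinalityE k; apply/cardinality_leP. Qed.

Lemma cardinal_le_trans (l k m : cardinal) :
  cardinal_le k l -> cardinal_le l m -> cardinal_le k m.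
Proof.
have [T ->] := cardinalityE k; have [U ->] := cardinalityE l.
have [V ->] := cardinalityE m => /cardinality_leP TU /cardinality_leP UV.
exact/cardinality_leP/(card_le_trans TU UV).
Qed.

Lemma cardinal_le_anti (k l : cardinal) :
  cardinal_le k l -> cardinal_le l k -> k = l.
Proof.
have [T ->] := cardinalityE k; have [U ->] := cardinalityE l.
move=> /cardinality_leP TU /cardinality_leP UT.
by apply/cardinality_eqP; rewrite card_eq_le TU UT.
Qed.

Lemma is_least_unique (S : cardinal -> Prop) (k l : cardinal) :
  is_least S k -> is_least S l -> k = l.
Proof.
move=> [Sk kmin] [Sl lmin].
by apply: cardinal_le_anti; [exact: kmin|exact: lmin].
Qed.

Lemma cardinal_min2_least (f : bool -> cardinal) :
  is_least (fun k => exists b, k = f b) (cardinal_min2 (f false) (f true)).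
Proof.
rewrite /cardinal_min2; case: asboolP => [le_ft|not_le_ft]; split.
- by exists false.
- by move=> _ [[] ->] //; exact: cardinal_le_refl.
- by exists true.
- move=> _ [[] ->]; first exact: cardinal_le_refl.
  by case: (cardinal_le_total (f false) (f true)).
Qed.

Lemma cardinal_min_le (d : cardinal) (S : cardinal -> Prop) (k : cardinal) :
  S k -> cardinal_le (cardinal_min d S) k.
Proof. by move=> Sk; have [|_] := @cardinal_minP d S; [exists k|apply]. Qed.

Lemma cardinal_min_le_default (d : cardinal) (S : cardinal -> Prop) :
  (forall k, S k -> cardinal_le k d) -> cardinal_le (cardinal_min d S) d.
Proof.
move=> Sd; have [/(cardinal_minP d)[/Sd]//|S0] := pselect (exists k, S k).
by rewrite cardinal_min0 //; exact: cardinal_le_refl.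
Qed.

Lemma cardinal_le_min (d : cardinal) (S : cardinal -> Prop) (l : cardinal) :
  cardinal_le l d -> (forall k, S k -> cardinal_le l k) ->
  cardinal_le l (cardinal_min d S).
Proof.
move=> ld lS; have [/(cardinal_minP d)[/lS]//|S0] := pselect (exists k, S k).
by rewrite cardinal_min0.
Qed.

Lemma continuum_le_succ : cardinal_le continuum continuum_succ.
Proof. by have [[]] := continuum_succP. Qed.

Lemma cardinality_families_le_continuum (N X : countType)
    (F : set (N -> set X)) : cardinal_le (cardinality F) continuum.
Proof.
pose code (E : N -> set X) : set nat :=
  [set m | if unpickle m is Some (n, x) then E n x else False].
apply/cardinality_leP/(card_le_trans (card_leT F)).
apply: (@inj_type_card_le _ _ code) => D E codeDE.
apply/funext => n; apply/funext => x.
by have := congr1 (@^~ (pickle (n, x))) codeDE; rewrite /code /mkset !pickleK.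
Qed.

(* [s] is the identity for [bnum] and the successor for [bsnum]. *)
Definition diagonal_union (X : Type) (s : nat -> nat) (A E : nat -> set X) :
    set X :=
  \bigcup_n (A (s n) `&` \bigcup_(i in [set i | (i <= n)%N]) E i).

Definition unbounded (X : Type) (s : nat -> nat) (I J : set (set X))
    (F : set (nat -> set X)) : Prop :=
  forall A, Ppart J A -> exists2 E, F E & ~ I (diagonal_union s A E).

Definition unbounded_number (X : Type) (s : nat -> nat) (I J K : set (set X)) :
    cardinal :=
  cardinal_min continuum_succ (fun k =>
    exists F, [/\ F `<=` Phat K, unbounded s I J F & k = cardinality F]).

Lemma bnumE (X : Type) (I J K : set (set X)) :
  bnum I J K = unbounded_number id I J K.
Proof. by []. Qed.

Lemma bsnumE (X : Type) (I J K : set (set X)) :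
  bsnum I J K = unbounded_number succn I J K.
Proof. by []. Qed.

Lemma not_unboundedP (X : Type) (s : nat -> nat) (I J : set (set X))
    (F : set (nat -> set X)) :
  ~ unbounded s I J F <->
  exists2 A, Ppart J A & forall E, F E -> I (diagonal_union s A E).
Proof.
split=> [/existsPNP[A JA /forallPNP bndA]|[A JA bndA] unbF].
  by exists A => // E /bndA/contrapT.
by have [E /bndA] := unbF A JA.
Qed.

Section UnboundedNumber.
Variables (X : Type) (s : nat -> nat) (I J K : set (set X)).

Lemma unbounded_number_le (F : set (nat -> set X)) :
  F `<=` Phat K -> unbounded s I J F ->
  cardinal_le (unbounded_number s I J K) (cardinality F).
Proof. by move=> FK unbF; apply: cardinal_min_le; exists F. Qed.

Lemma le_unbounded_number (k : cardinal) :
  cardinal_le k continuum_succ ->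
  (forall F, F `<=` Phat K -> unbounded s I J F ->
     cardinal_le k (cardinality F)) ->
  cardinal_le k (unbounded_number s I J K).
Proof.
by move=> kc kF; apply: cardinal_le_min => // _ [F [FK unbF ->]]; exact: kF.
Qed.

Lemma unbounded_number_attained :
  (exists F, [/\ F `<=` Phat K, unbounded s I J F &
                 unbounded_number s I J K = cardinality F]) \/
  unbounded_number s I J K = continuum_succ.
Proof.
rewrite /unbounded_number; set S := fun k => exists F, [/\ _, _ & k = _].
have [/(cardinal_minP continuum_succ)[]|/cardinal_min0 ->] :=
  pselect (exists k, S k); by [left|right].
Qed.

End UnboundedNumber.

Lemma unbounded_number_le_continuum_succ (X : countType) (s : nat -> nat)
    (I J K : set (set X)) :
  cardinal_le (unbounded_number s I J K) continuum_succ.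
Proof.
apply: cardinal_min_le_default => _ [F [_ _ ->]].
apply: cardinal_le_trans continuum_le_succ.
exact: cardinality_families_le_continuum.
Qed.

Lemma ideal_set0 (X : Type) (I : set (set X)) : is_ideal I -> I set0.
Proof. by move=> [_ _ IF _]; exact/IF/finite_set0. Qed.

Definition indexed_sum (X B : Type) (I : B -> set (set X)) :
    set (set (X * B)) :=
  [set A | forall b, I b (pair^~ b @^-1` A)].

Lemma ideal_sumE (I J : set (set nat)) :
  ideal_sum I J = indexed_sum (fun b : bool => if b then J else I).
Proof.
apply/seteqP; split=> A; first by move=> [IA JA] [].
by move=> IJA; split; [exact: (IJA false)|exact: (IJA true)].
Qed.

Lemma indexed_sum_Fin (X : Type) (B : finType) :
  indexed_sum (fun _ : B => @Fin X) = Fin.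
Proof.
apply/seteqP; split=> A finA => [|b]; last first.
  by apply: finite_preimage finA => x y _ _ [].
have -> : A = \bigcup_b pair^~ b @` (pair^~ b @^-1` A).
  apply/seteqP; split=> [[x b] Axb|_ [b _ [x Axb <-]]] //.
  by exists b => //; exists x.
by apply: bigcup_finite => // b _; apply/finite_image/finA.
Qed.

Section Slices.
Variables X B : Type.

Definition slice (b : B) (E : nat -> set (X * B)) (n : nat) : set X :=
  pair^~ b @^-1` E n.

Definition glue (E : B -> nat -> set X) (n : nat) : set (X * B) :=
  [set p | E p.2 n p.1].

Definition extend (b : B) (E : nat -> set X) (n : nat) : set (X * B) :=
  pair^~ b @` E n.

Lemma slice_glue (b : B) (E : B -> nat -> set X) : slice b (glue E) = E b.
Proof. by []. Qed.

Lemma slice_extend (b : B) : cancel (extend b) (slice b).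
Proof.
by move=> E; apply/funext => n; apply/funext => x; apply: image_inj => y z [].
Qed.

Lemma slice_extend_neq (b c : B) (E : nat -> set X) :
  b <> c -> slice c (extend b E) = fun=> set0.
Proof.
by move=> bc; apply/funext => n; apply/seteqP; split=> // x [y _ [_ /bc]].
Qed.

Lemma slice_diagonal_union (s : nat -> nat) (A E : nat -> set (X * B)) (b : B) :
  pair^~ b @^-1` diagonal_union s A E
    = diagonal_union s (slice b A) (slice b E).
Proof. by []. Qed.

Lemma Phat_sliceP (K : B -> set (set X)) (E : nat -> set (X * B)) :
  Phat (indexed_sum K) E <-> forall b, Phat (K b) (slice b E).
Proof.
split=> [[KE disjE] b|KE].
  split=> [n|i j _ _ [x [Ei Ej]]]; first exact: KE.
  by apply: disjE => //; exists (x, b).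
split=> [n b|i j _ _ [[x b] [Ei Ej]]]; have [KEb disjE] := KE b.
  exact: KEb.
by apply: disjE => //; exists x.
Qed.

Lemma Ppart_sliceP (J : B -> set (set X)) (A : nat -> set (X * B)) :
  Ppart (indexed_sum J) A <-> forall b, Ppart (J b) (slice b A).
Proof.
split=> [[/Phat_sliceP JA covA] b|JA].
  by split; [exact: JA|rewrite -preimage_bigcup covA].
split; first by apply/Phat_sliceP => b; have [] := JA b.
apply/seteqP; split=> // -[x b] _; have [_ covA] := JA b.
by have : (\bigcup_n slice b A n) x by rewrite covA.
Qed.

Lemma Phat_extend (K : B -> set (set X)) (b : B) (E : nat -> set X) :
  (forall c, K c set0) -> Phat (K b) E -> Phat (indexed_sum K) (extend b E).
Proof.
move=> K0 KE; apply/Phat_sliceP => c.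
have [<-|bc] := pselect (b = c); first by rewrite slice_extend.
by rewrite slice_extend_neq //; split=> //; exact: trivIset_set0.
Qed.

Lemma unbounded_extend (s : nat -> nat) (I J : B -> set (set X)) (b : B)
    (F : set (nat -> set X)) :
  unbounded s (I b) (J b) F ->
  unbounded s (indexed_sum I) (indexed_sum J) (extend b @` F).
Proof.
move=> unbF A /Ppart_sliceP/(_ b)/unbF[E FE nIE].
exists (extend b E); first by exists E.
by move=> /(_ b); rewrite slice_diagonal_union slice_extend.
Qed.

Lemma unbounded_slice (s : nat -> nat) (I J : B -> set (set X))
    (F : set (nat -> set (X * B))) :
  unbounded s (indexed_sum I) (indexed_sum J) F ->
  exists b, unbounded s (I b) (J b) (slice b @` F).
Proof.
apply: contraPP => /forallNP bndF; apply/not_unboundedP.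
have bnd b : exists A, Ppart (J b) A /\
    forall E, F E -> I b (diagonal_union s A (slice b E)).
  have /not_unboundedP[A JA bndA] := bndF b.
  by exists A; split=> // E FE; apply: bndA; exists E.
have [A bndA] := choice bnd.
exists (glue A).
  by apply/Ppart_sliceP => b; rewrite slice_glue; have [] := bndA b.
move=> E FE b; rewrite slice_diagonal_union slice_glue.
by have [_] := bndA b; apply.
Qed.

End Slices.

Section IndexedSum.
Variables (X B : countType) (s : nat -> nat) (I J K : B -> set (set X)).

Lemma unbounded_number_indexed_sum_le (b : B) :
  (forall c, K c set0) ->
  cardinal_le
    (unbounded_number s (indexed_sum I) (indexed_sum J) (indexed_sum K))
    (unbounded_number s (I b) (J b) (K b)).
Proof.
move=> K0; apply: le_unbounded_number => [|F FK unbF].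
  exact: unbounded_number_le_continuum_succ.
have -> : cardinality F = cardinality (extend b @` F).
  apply/cardinality_eqP; rewrite card_eq_sym; apply: inj_card_eq => D E _ _.
  exact: (can_inj (slice_extend b)).
apply: unbounded_number_le; last exact: unbounded_extend.
by move=> _ [E /FK KE <-]; exact: Phat_extend.
Qed.

Lemma unbounded_number_slice_le (F : set (nat -> set (X * B))) :
  F `<=` Phat (indexed_sum K) ->
  unbounded s (indexed_sum I) (indexed_sum J) F ->
  exists b, cardinal_le (unbounded_number s (I b) (J b) (K b)) (cardinality F).
Proof.
move=> FK /unbounded_slice[b unbF]; exists b.
apply: (@cardinal_le_trans (cardinality (slice b @` F))).
  by apply: unbounded_number_le => // _ [E /FK/Phat_sliceP KE <-].
exact/cardinality_leP/card_image_le.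
Qed.

Lemma unbounded_number_indexed_sum_least :
  inhabited B -> (forall b, K b set0) ->
  is_least (fun k => exists b, k = unbounded_number s (I b) (J b) (K b))
    (unbounded_number s (indexed_sum I) (indexed_sum J) (indexed_sum K)).
Proof.
move=> [b0] K0; split=> [|_ [b ->]]; last first.
  exact: unbounded_number_indexed_sum_le.
suff [b le_sum] : exists b, cardinal_le (unbounded_number s (I b) (J b) (K b))
    (unbounded_number s (indexed_sum I) (indexed_sum J) (indexed_sum K)).
  exists b; apply: cardinal_le_anti le_sum.
  exact: unbounded_number_indexed_sum_le.
have [[F [FK unbF ->]]|->] := unbounded_number_attained s
    (indexed_sum I) (indexed_sum J) (indexed_sum K).
- exact: unbounded_number_slice_le.
- by exists b0; exact: unbounded_number_le_continuum_succ.
Qed.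

End IndexedSum.

Lemma ideal_sum_Fin : ideal_sum Fin Fin = Fin.
Proof.
rewrite ideal_sumE -indexed_sum_Fin; congr indexed_sum.
by apply/funext => -[].
Qed.

Lemma unbounded_number_ideal_sum (s : nat -> nat)
    (I I' J J' K K' : set (set nat)) :
  K set0 -> K' set0 ->
  unbounded_number s (ideal_sum I I') (ideal_sum J J') (ideal_sum K K')
    = cardinal_min2 (unbounded_number s I J K) (unbounded_number s I' J' K').
Proof.
move=> K0 K'0; rewrite !ideal_sumE.
apply: is_least_unique (cardinal_min2_least (fun b : bool =>
  unbounded_number s (if b then I' else I) (if b then J' else J)
                     (if b then K' else K))).
apply: unbounded_number_indexed_sum_least; first exact: inhabits true.
by case.
Qed.

Theorem theorem5p1 (I J : set (set nat)) (hI : is_ideal I) (hJ : is_ideal J) :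
  [/\ bnum (ideal_sum I J) (ideal_sum I J) (ideal_sum I J)
        = cardinal_min2 (bnum I I I) (bnum J J J),
      bnum (ideal_sum I J) (ideal_sum I J) Fin
        = cardinal_min2 (bnum I I Fin) (bnum J J Fin),
      bnum (ideal_sum I J) Fin Fin
        = cardinal_min2 (bnum I Fin Fin) (bnum J Fin Fin)
    & bsnum Fin (ideal_sum I J) (ideal_sum I J)
        = cardinal_min2 (bsnum Fin I I) (bsnum Fin J J)].
Proof.
have I0 := ideal_set0 hI; have J0 := ideal_set0 hJ.
have Fin0 : Fin (set0 : set nat) by exact: finite_set0.
by rewrite !bnumE !bsnumE -ideal_sum_Fin; split;
   exact: unbounded_number_ideal_sum.
Qed.
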